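(* Let $q\in\mathbb{C}\setminus\{0\}$ be not a root of unity, let $\mathcal{A}_q=\mathcal{A}_q(x,\xi,\theta,z)$ be the algebra of polynomials on the double-graded quantum superplane, and let $(\Omega(\mathcal{A}_q),\mathrm{d})$ be the differential calculus over $\mathcal{A}_q$ with the coordinate–differential commutation rules listed in the context. Then the (non-trivial) commutation rules between the differentials are: $$\mathrm{d}x\,\mathrm{d}\xi=-q\,\mathrm{d}\xi\,\mathrm{d}x,\qquad \mathrm{d}x\,\mathrm{d}\theta=-q\,\mathrm{d}\theta\,\mathrm{d}x,\qquad \mathrm{d}x\,\mathrm{d}z=-\mathrm{d}z\,\mathrm{d}x,$$ $$\mathrm{d}\xi\,\mathrm{d}\theta=-\mathrm{d}\theta\,\mathrm{d}\xi,\qquad \mathrm{d}\xi\,\mathrm{d}z=q^{-1}\mathrm{d}z\,\mathrm{d}\xi,\qquad \mathrm{d}\theta\,\mathrm{d}z=q^{-1}\mathrm{d}z\,\mathrm{d}\theta.$$ Moreover, $(\mathrm{d}x)^2=(\mathrm{d}z)^2=0$.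
   Context: The base field is $\mathbb{C}$ and $\mathbb{Z}_2^2=\mathbb{Z}_2\times\mathbb{Z}_2$. $\mathcal{A}_q=\mathcal{A}_q(x,\xi,\theta,z)$ is the $\mathbb{Z}_2^2$-graded, associative, unital algebra generated by $x,\xi,\theta,z$ of degrees $(0,0),(0,1),(1,0),(1,1)$ respectively, subject to the relations $$x\xi=q\,\xi x,\quad x\theta=q\,\theta x,\quad xz=zx,\quad \xi^2=0,\quad \theta^2=0,\quad \xi\theta=\theta\xi,\quad \xi z=-q^{-1}z\xi,\quad \theta z=-q^{-1}z\theta.$$ A (higher-order) differential calculus over $\mathcal{A}_q$ is an $\mathbb{N}\times\mathbb{Z}_2^2$-graded algebra $\Omega(\mathcal{A}_q)=\bigoplus_{p\ge0}\Omega^p(\mathcal{A}_q)$ with $\Omega^0(\mathcal{A}_q)\cong\mathcal{A}_q$, together with a linear map $\mathrm{d}:\Omega^p(\mathcal{A}_q)\to\Omega^{p+1}(\mathcal{A}_q)$ of $\mathbb{N}\times\mathbb{Z}_2^2$-degree $(1,0,0)$ such that $\mathrm{d}^2=0$; $\mathrm{d}(\alpha\beta)=(\mathrm{d}\alpha)\beta+(-1)^p\alpha\,\mathrm{d}\beta$ for $\alpha\in\Omega^p(\mathcal{A}_q)$, $\beta\in\Omega(\mathcal{A}_q)$; and $\Omega(\mathcal{A}_q)$ is generated by $\mathcal{A}_q$ and $\Omega^1(\mathcal{A}_q)=\mathrm{Span}\{a\,\mathrm{d}b\}$. The calculus considered is one in which the following commutation rules between coordinates and differentials hold: $$x\,\mathrm{d}x=\mathrm{d}x\,x,\quad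 x\,\mathrm{d}\xi=q\,\mathrm{d}\xi\,x,\quad x\,\mathrm{d}\theta=q\,\mathrm{d}\theta\,x,\quad x\,\mathrm{d}z=\mathrm{d}z\,x,$$ $$\xi\,\mathrm{d}x=q^{-1}\mathrm{d}x\,\xi,\quad \xi\,\mathrm{d}\xi=-\mathrm{d}\xi\,\xi,\quad \xi\,\mathrm{d}\theta=\mathrm{d}\theta\,\xi,\quad \xi\,\mathrm{d}z=-q^{-1}\mathrm{d}z\,\xi,$$ $$\theta\,\mathrm{d}x=q^{-1}\mathrm{d}x\,\theta,\quad \theta\,\mathrm{d}\xi=\mathrm{d}\xi\,\theta,\quad \theta\,\mathrm{d}\theta=-\mathrm{d}\theta\,\theta,\quad \theta\,\mathrm{d}z=-q^{-1}\mathrm{d}z\,\theta,$$ $$z\,\mathrm{d}x=\mathrm{d}x\,z,\quad z\,\mathrm{d}\xi=-q\,\mathrm{d}\xi\,z,\quad z\,\mathrm{d}\theta=-q\,\mathrm{d}\theta\,z,\quad z\,\mathrm{d}z=\mathrm{d}z\,z.$$ The rules between differentials are those obtained by applying $\mathrm{d}$ to these rules. *)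

(* Defs.v *)
From mathcomp Require Import all_boot all_order all_algebra.
From mathcomp Require Export reals complex.

Set Implicit Arguments.
Unset Strict Implicit.
Unset Printing Implicit Defensive.

Import GRing.Theory.
Local Open Scope ring_scope.

Definition Z22 : nmodType := ('Z_2 * 'Z_2)%type.

(* [H g] is the subspace of homogeneous elements of degree [g].  The two
   conditions on finite families [w] say that the sum of the [H g] is all of
   [A] and that it is direct. *)
Record graded_algebra (K : fieldType) (G : nmodType) (A : algType K)
    (H : G -> {pred A}) : Prop := GradedAlgebra {
  graded_submod : forall g, submod_closed (H g);
  graded_one : 1 \in H 0;
  graded_mul : forall g h a b, a \in H g -> b \in H h -> a * b \in H (g + h);
  graded_total : forall a, exists (s : seq G) (w : G -> A),
    [/\ uniq s, forall g, w g \in H g & a = \sum_(g <- s) w g];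
  graded_direct : forall (s : seq G) (w : G -> A),
    uniq s -> (forall g, w g \in H g) -> \sum_(g <- s) w g = 0 ->
    forall g, g \in s -> w g = 0
}.

Record superplane_relations (K : fieldType) (q : K) (A : algType K)
    (x xi theta z : A) : Prop := SuperplaneRelations {
  rel_x_xi : x * xi = q *: (xi * x);
  rel_x_theta : x * theta = q *: (theta * x);
  rel_x_z : x * z = z * x;
  rel_xi_xi : xi ^+ 2 = 0;
  rel_theta_theta : theta ^+ 2 = 0;
  rel_xi_theta : xi * theta = theta * xi;
  rel_xi_z : xi * z = - q^-1 *: (z * xi);
  rel_theta_z : theta * z = - q^-1 *: (z * theta)
}.

(* "Generated by x, xi, theta, z subject to the relations" is the universal
   property of the presentation. *)
Record quantum_superplane (K : fieldType) (q : K) (A : algType K)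
    (HA : Z22 -> {pred A}) (x xi theta z : A) : Prop := QuantumSuperplane {
  superplane_graded : graded_algebra HA;
  superplane_deg : [/\ x \in HA (0, 0), xi \in HA (0, 1),
                       theta \in HA (1, 0) & z \in HA (1, 1)];
  superplane_rel : superplane_relations q x xi theta z;
  superplane_lift : forall (B : algType K) (x' xi' theta' z' : B),
    superplane_relations q x' xi' theta' z' ->
    exists f : {lrmorphism A -> B},
      [/\ f x = x', f xi = xi', f theta = theta' & f z = z'];
  superplane_lift_uniq : forall (B : algType K) (f g : {lrmorphism A -> B}),
    [/\ f x = g x, f xi = g xi, f theta = g theta & f z = g z] -> f =1 g
}.

Definition p_form (K : fieldType) (Om : algType K)
    (H : (nat * Z22)%type -> {pred Om}) (p : nat) (w : Om) : Prop :=
  exists f : Z22 -> Om,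
    (forall g, f g \in H (p, g)) /\ w = \sum_(g : 'Z_2 * 'Z_2) f g.

(* [iota] is the isomorphism of [A] with the algebra of 0-forms, viewed as an
   embedding into [Om]. *)
Record differential_calculus (K : fieldType) (A : algType K)
    (HA : Z22 -> {pred A}) (Om : algType K)
    (H : (nat * Z22)%type -> {pred Om})
    (iota : {lrmorphism A -> Om}) (d : {linear Om -> Om}) : Prop :=
  DifferentialCalculus {
  calc_graded : graded_algebra H;
  calc_iota_inj : injective iota;
  calc_iota_deg : forall g a, a \in HA g -> iota a \in H (0%N, g);
  calc_iota_surj : forall w, p_form H 0 w -> exists a, w = iota a;
  calc_d_deg : forall p g w, w \in H (p, g) -> d w \in H (p.+1, g);
  calc_d_d : forall w, d (d w) = 0;
  calc_leibniz : forall p alpha beta, p_form H p alpha ->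
    d (alpha * beta) = d alpha * beta + (-1) ^+ p * (alpha * d beta);
  calc_one_forms : forall w, p_form H 1 w <->
    exists s : seq (A * A), w = \sum_(ab <- s) iota ab.1 * d (iota ab.2);
  calc_generated : forall S : {pred Om}, GRing.subalg_closed S ->
    (forall a, iota a \in S) -> (forall w, p_form H 1 w -> w \in S) ->
    forall w, w \in S
}.

(* The coordinates are numbered x, xi, theta, z.  The rule between the i-th
   coordinate and the differential of the j-th is
     u_i * d u_j = cd_coef q i j *: (d u_j * u_i). *)
Definition coordinate (K : fieldType) (A : algType K) (x xi theta z : A)
    (i : 'I_4) : A := nth 0 [:: x; xi; theta; z] i.

Definition cd_coef (K : fieldType) (q : K) (i j : 'I_4) : K :=
  nth 0 (nth [::] [:: [:: 1    ; q   ; q   ; 1      ];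
                      [:: q^-1 ; -1  ; 1   ; - q^-1 ];
                      [:: q^-1 ; 1   ; -1  ; - q^-1 ];
                      [:: 1    ; - q ; - q ; 1      ]] i) j.

Definition cd_rules (K : fieldType) (q : K) (Om : algType K)
    (d : {linear Om -> Om}) (u : 'I_4 -> Om) : Prop :=
  forall i j : 'I_4, u i * d (u j) = cd_coef q i j *: (d (u j) * u i).

(* Formal relations between coordinates and differentials: the pair (M, N)
   stands for
     \sum_(i, j) M i j u_i (d u_j) + \sum_(i, j) N i j (d u_i) u_j = 0,
   and the matrix C for \sum_(i, j) C i j (d u_i) (d u_j) = 0. *)
Definition eval_cd (K : fieldType) (Om : algType K) (d : {linear Om -> Om})
    (u : 'I_4 -> Om) (MN : 'M[K]_4 * 'M[K]_4) : Om :=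
  \sum_(i < 4) \sum_(j < 4)
    (MN.1 i j *: (u i * d (u j)) + MN.2 i j *: (d (u i) * u j)).

Definition eval_dd (K : fieldType) (Om : algType K) (d : {linear Om -> Om})
    (u : 'I_4 -> Om) (C : 'M[K]_4) : Om :=
  \sum_(i < 4) \sum_(j < 4) C i j *: (d (u i) * d (u j)).

Definition formal_d (K : fieldType) (MN : 'M[K]_4 * 'M[K]_4) : 'M[K]_4 :=
  MN.1 - MN.2.

Definition cd_rule (K : fieldType) (q : K) (i j : 'I_4) :
    'M[K]_4 * 'M[K]_4 :=
  (delta_mx i j, - cd_coef q i j *: delta_mx j i).

Definition derived_dd_rules (K : fieldType) (q : K) : seq 'M[K]_4 :=
  [seq formal_d (cd_rule q i j) | i <- enum 'I_4, j <- enum 'I_4].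

Lemma p_form_homog (K : fieldType) (Om : algType K)
    (H : (nat * Z22)%type -> {pred Om}) (p : nat) (g : Z22) (w : Om) :
  graded_algebra H -> w \in H (p, g) -> p_form H p w.
Proof.
move=> grH Hw; exists (fun h => if h == g then w else 0); split.
  move=> h; case: eqP => [->//|_].
  by have [] := graded_submod grH (p, h).
by rewrite -big_mkcond big_pred1_eq.
Qed.

(* [formal_d] computes the differential of the left-hand side. *)
Lemma eval_formal_d (K : fieldType) (A : algType K) (HA : Z22 -> {pred A})
    (Om : algType K) (H : (nat * Z22)%type -> {pred Om})
    (iota : {lrmorphism A -> Om}) (d : {linear Om -> Om})
    (u : 'I_4 -> Om) (MN : 'M[K]_4 * 'M[K]_4) :
  differential_calculus HA H iota d ->
  (forall i, exists g, u i \in H (0%N, g)) ->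
  d (eval_cd d u MN) = eval_dd d u (formal_d MN).
Proof.
move=> calc Hu; rewrite /eval_cd /eval_dd linear_sum; apply: eq_bigr => i _.
rewrite linear_sum; apply: eq_bigr => j _.
have [g ug] := Hu i.
have u0 := p_form_homog (calc_graded calc) ug.
have u1 := p_form_homog (calc_graded calc) (calc_d_deg calc ug).
rewrite linearD !linearZ /= (calc_leibniz calc _ u0) (calc_leibniz calc _ u1).
rewrite !(calc_d_d calc) mulr0 mulr0 mul0r addr0 add0r expr1 mulN1r.
by rewrite scalerN !mxE scalerBl.
Qed.

Lemma eval_cd_rule (K : fieldType) (q : K) (Om : algType K)
    (d : {linear Om -> Om}) (u : 'I_4 -> Om) (i j : 'I_4) :
  eval_cd d u (cd_rule q i j)
    = u i * d (u j) - cd_coef q i j *: (d (u j) * u i).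
Proof.
have sum_delta (F : 'I_4 -> 'I_4 -> Om) (k l : 'I_4) :
    \sum_(i0 < 4) \sum_(j0 < 4) (delta_mx k l : 'M[K]_4) i0 j0 *: F i0 j0
    = F k l.
  rewrite (bigD1 k) //= [X in _ + X]big1 ?addr0 => [|i0 /negPf n].
    rewrite (bigD1 l) //= big1 ?addr0 => [|j0 /negPf n].
      by rewrite mxE !eqxx scale1r.
    by rewrite mxE n andbF scale0r.
  by apply: big1 => j0 _; rewrite mxE n scale0r.
rewrite /eval_cd /=.
under eq_bigr do rewrite big_split /=.
rewrite big_split /= (sum_delta (fun i0 j0 => u i0 * d (u j0))).
congr (_ + _); rewrite -scaleNr -(sum_delta (fun i0 j0 => d (u i0) * u j0) j i).
rewrite scaler_sumr; apply: eq_bigr => i0 _; rewrite scaler_sumr.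
by apply: eq_bigr => j0 _; rewrite [in LHS]mxE scalerA.
Qed.

(* The monomial (d u_i) (d u_j). *)
Definition dd_mx (K : fieldType) (i j : nat) : 'M[K]_4 :=
  delta_mx (inord i) (inord j).

(* The matrices of
     dx dxi + q dxi dx, dx dtheta + q dtheta dx, dx dz + dz dx,
     dxi dtheta + dtheta dxi, dxi dz - q^-1 dz dxi,
     dtheta dz - q^-1 dz dtheta, (dx)^2, (dz)^2. *)
Definition listed_dd_rules (K : fieldType) (q : K) : seq 'M[K]_4 :=
  [:: dd_mx K 0 1 + q *: dd_mx K 1 0;
      dd_mx K 0 2 + q *: dd_mx K 2 0;
      dd_mx K 0 3 + dd_mx K 3 0;
      dd_mx K 1 2 + dd_mx K 2 1;
      dd_mx K 1 3 - q^-1 *: dd_mx K 3 1;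
      dd_mx K 2 3 - q^-1 *: dd_mx K 3 2;
      dd_mx K 0 0;
      dd_mx K 3 3].

(* Main.v *)
Require Import Defs.
From HB Require Import structures.
From mathcomp Require Import all_boot all_order all_algebra.
From mathcomp Require Import reals complex.

Set Implicit Arguments.
Unset Strict Implicit.
Unset Printing Implicit Defensive.

Import GRing.Theory.
Local Open Scope ring_scope.

(* Applying d to u_i (d u_j) = c_ij (d u_j) u_i gives
   (d u_i) (d u_j) = - c_ij (d u_j) (d u_i).  Since c_ij c_ji = 1, the rules for
   (i, j) and (j, i) are proportional, so one per pair i < j remains; on the
   diagonal the rule is (1 + c_ii) (d u_i)^2 = 0, which is void when c_ii = -1
   (for xi and theta) and says (d u_i)^2 = 0 when c_ii = 1 (for x and z). *)

(** Applied to [eval_dd], this reduces the vanishing of all combinations of derived rules to that of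
    the sixteen rules themselves. *)
Lemma linear_span_eq0 (K : fieldType) (V : vectType K) (W : lmodType K)
    (f : {linear V -> W}) (X : seq V) (v : V) :
  (forall w, w \in X -> f w = 0) -> v \in <<X>>%VS -> f v = 0.
Proof.
move=> fX0 /(coord_span (X := in_tuple X)) ->.
rewrite linear_sum big1 // => i _.
by rewrite linearZ /= fX0 ?scaler0 // mem_nth.
Qed.

Section EvalDD.
Variables (K : fieldType) (Om : algType K) (d : {linear Om -> Om}).
Variable u : 'I_4 -> Om.

Lemma eval_dd_is_linear : linear (eval_dd d u).
Proof.
move=> a C D; rewrite /eval_dd scaler_sumr -big_split; apply: eq_bigr => i _.
rewrite scaler_sumr -big_split; apply: eq_bigr => j _ /=.
by rewrite !mxE scalerDl scalerA.
Qed.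

HB.instance Definition _ :=
  GRing.isLinear.Build K 'M[K]_4 Om _ (eval_dd d u) eval_dd_is_linear.

Lemma eval_dd_delta (i j : 'I_4) :
  eval_dd d u (delta_mx i j) = d (u i) * d (u j).
Proof.
rewrite /eval_dd (bigD1 i) //= [X in _ + X]big1 => [|k /negPf nk].
  rewrite addr0 (bigD1 j) //= big1 => [|l /negPf nl].
    by rewrite mxE !eqxx scale1r addr0.
  by rewrite mxE nl andbF scale0r.
by apply: big1 => l _; rewrite mxE nk scale0r.
Qed.

End EvalDD.

Lemma formal_d_cd_rule (K : fieldType) (q : K) (i j : 'I_4) :
  formal_d (cd_rule q i j) = delta_mx i j + cd_coef q i j *: delta_mx j i.
Proof. by rewrite /formal_d /= scaleNr opprK. Qed.

Lemma formal_d_cd_rule_dd (K : fieldType) (q : K) (i j : 'I_4) :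
  formal_d (cd_rule q i j) = dd_mx K i j + cd_coef q i j *: dd_mx K j i.
Proof. by rewrite formal_d_cd_rule /dd_mx !inord_val. Qed.

Lemma mem_derived_dd_rules (K : fieldType) (q : K) (i j : 'I_4) :
  formal_d (cd_rule q i j) \in derived_dd_rules q.
Proof. by apply: allpairs_f; rewrite mem_enum. Qed.

(** A derived rule with i < j is itself listed; one with i > j is c_ij times the listed rule for (j,
    i); a diagonal one is zero or twice a listed square. *)
Lemma derived_sub_listed (K : fieldType) (q : K) : q != 0 ->
  (<<derived_dd_rules q>> <= <<listed_dd_rules q>>)%VS.
Proof.
move=> q0; apply/span_subvP => _ /allpairsP[[i j] [_ _ ->]] /=.
have listed a k : (k < 8)%N ->
    a *: (listed_dd_rules q)`_k \in <<listed_dd_rules q>>%VS.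
  by move=> k8; rewrite memvZ // memv_span // mem_nth.
rewrite formal_d_cd_rule_dd /cd_coef.
have double (v : 'M[K]_4) : v + 1 *: v = 2 *: v.
  by rewrite scaler_nat mulr2n scale1r.
(* Sixteen cases, row by row; the natural number passed to [listed] is a position in
   [listed_dd_rules]. *)
case: i => [[|[|[|[|//]]]] ?]; case: j => [[|[|[|[|//]]]] ?] /=.
- by rewrite double (listed _ 6%N).
- by have := listed 1 0%N isT; rewrite scale1r.
- by have := listed 1 1%N isT; rewrite scale1r.
- by have := listed 1 2%N isT; rewrite !scale1r.
- by have := listed q^-1 0%N isT; rewrite scalerDr scalerA mulVf // scale1r addrC.
- by rewrite scaleN1r subrr mem0v.
- by have := listed 1 3%N isT; rewrite !scale1r.
- by have := listed 1 4%N isT; rewrite scale1r scaleNr.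
- by have := listed q^-1 1%N isT; rewrite scalerDr scalerA mulVf // scale1r addrC.
- by have := listed 1 3%N isT; rewrite !scale1r addrC.
- by rewrite scaleN1r subrr mem0v.
- by have := listed 1 5%N isT; rewrite scale1r scaleNr.
- by have := listed 1 2%N isT; rewrite !scale1r addrC.
- have := listed (- q) 4%N isT.
  by rewrite scalerBr scalerA mulNr divff // scaleN1r opprK addrC.
- have := listed (- q) 5%N isT.
  by rewrite scalerBr scalerA mulNr divff // scaleN1r opprK addrC.
- by rewrite double (listed _ 7%N).
Qed.

(** The six mixed listed rules are the derived rules with i < j. The two squares occur among the
    derived rules only doubled, hence the division by 2. *)
Lemma listed_sub_derived (K : fieldType) (q : K) : (2 : K) != 0 ->
  (<<listed_dd_rules q>> <= <<derived_dd_rules q>>)%VS.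
Proof.
move=> two0; apply/span_subvP => v.
have derived i j : (i < 4)%N -> (j < 4)%N ->
    dd_mx K i j + cd_coef q (inord i) (inord j) *: dd_mx K j i
      \in <<derived_dd_rules q>>%VS.
  move=> i4 j4; have := mem_derived_dd_rules q (inord i) (inord j).
  by rewrite formal_d_cd_rule_dd !inordK //; apply: memv_span.
have half (w : 'M[K]_4) : w = 2^-1 *: (w + 1 *: w).
  by rewrite scale1r -mulr2n -scaler_nat scalerA mulVf // scale1r.
rewrite !inE => /or4P[/eqP->|/eqP->|/eqP->|].
- by have := derived 0%N 1%N isT isT; rewrite /cd_coef !inordK.
- by have := derived 0%N 2%N isT isT; rewrite /cd_coef !inordK.
- by have := derived 0%N 3%N isT isT; rewrite /cd_coef !inordK //= scale1r.
case/or4P=> [/eqP->|/eqP->|/eqP->|/orP[]/eqP->].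
- by have := derived 1%N 2%N isT isT; rewrite /cd_coef !inordK //= scale1r.
- by have := derived 1%N 3%N isT isT; rewrite /cd_coef !inordK //= scaleNr.
- by have := derived 2%N 3%N isT isT; rewrite /cd_coef !inordK //= scaleNr.
- rewrite [dd_mx _ _ _]half memvZ //.
  by have := derived 0%N 0%N isT isT; rewrite /cd_coef !inordK.
- rewrite [dd_mx _ _ _]half memvZ //.
  by have := derived 3%N 3%N isT isT; rewrite /cd_coef !inordK.
Qed.

(** The formal rule evaluates to the difference of its two sides, which is zero in [Om]; applying
    [d] to it gives zero again, and [eval_formal_d] computes this differential. *)
Lemma eval_derived_dd (K : fieldType) (q : K) (A : algType K)
    (HA : Z22 -> {pred A}) (Om : algType K) (H : (nat * Z22)%type -> {pred Om})
    (iota : {lrmorphism A -> Om}) (d : {linear Om -> Om}) (u : 'I_4 -> Om) :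
  differential_calculus HA H iota d ->
  (forall i, exists g, u i \in H (0%N, g)) -> cd_rules q d u ->
  forall i j, eval_dd d u (formal_d (cd_rule q i j)) = 0.
Proof.
move=> calc Hu rules i j.
by rewrite -(eval_formal_d _ calc Hu) eval_cd_rule rules subrr linear0.
Qed.

Theorem theorem3 (R : realType) (q : R[i])
    (q_neq0 : q != 0) (q_not_root : forall n : nat, (0 < n)%N -> q ^+ n != 1)
    (A : algType R[i]) (HA : Z22 -> {pred A}) (x xi theta z : A)
    (A_superplane : quantum_superplane q HA x xi theta z)
    (Om : algType R[i]) (H : (nat * Z22)%type -> {pred Om})
    (iota : {lrmorphism A -> Om}) (d : {linear Om -> Om})
    (Om_calculus : differential_calculus HA H iota d)
    (Om_rules : cd_rules q d
       (coordinate (iota x) (iota xi) (iota theta) (iota z))) :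
  let u := coordinate (iota x) (iota xi) (iota theta) (iota z) in
  let dx := d (iota x) in
  let dxi := d (iota xi) in
  let dtheta := d (iota theta) in
  let dz := d (iota z) in
  (* the rules hold *)
  [/\ [/\ dx * dxi = - q *: (dxi * dx),
          dx * dtheta = - q *: (dtheta * dx) &
          dx * dz = - (dz * dx)],
      [/\ dxi * dtheta = - (dtheta * dxi),
          dxi * dz = q^-1 *: (dz * dxi) &
          dtheta * dz = q^-1 *: (dz * dtheta)] &
      dx ^+ 2 = 0 /\ dz ^+ 2 = 0]
  /\
  (* and if all rules between differentials are obtained by applying d to the
     coordinate-differential rules, then there are no others *)
  ((forall C : 'M[R[i]]_4,
      eval_dd d u C = 0 -> C \in <<derived_dd_rules q>>%VS) ->
   forall C : 'M[R[i]]_4,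
     eval_dd d u C = 0 <-> C \in <<listed_dd_rules q>>%VS).
Proof.
move=> u dx dxi dtheta dz.
(* The coordinates are homogeneous 0-forms, so the Leibniz rule produces exactly the signs of
   [formal_d]. *)
have Hu i : exists g, u i \in H (0%N, g).
  have [Hx Hxi Htheta Hz] := superplane_deg A_superplane.
  case: i => [[|[|[|[|//]]]] ?]; rewrite /u /coordinate /=;
    by eexists; apply: (calc_iota_deg Om_calculus); eassumption.
have two0 : (2 : R[i]) != 0 by rewrite Num.Theory.pnatr_eq0.
have derived0 := eval_derived_dd Om_calculus Hu Om_rules.
have dd i j : d (u i) * d (u j) = - cd_coef q i j *: (d (u j) * d (u i)).
  apply/eqP; rewrite scaleNr -addr_eq0 -(derived0 i j) formal_d_cd_rule.
  by rewrite linearD linearZ /= !eval_dd_delta.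
have sq i : cd_coef q i i = 1 -> d (u i) ^+ 2 = 0.
  move=> c1; have /eqP := dd i i; rewrite c1 scaleN1r -addr_eq0 -mulr2n.
  by rewrite -scaler_nat scaler_eq0 (negPf two0) -expr2 => /eqP.
(* With explicit ordinals, [coordinate] and [cd_coef] compute, so the stated rules are instances of
   [dd] and [sq] up to conversion and signs. *)
pose o k (k4 : (k < 4)%N) : 'I_4 := Ordinal k4.
split.
  split; split.
  - exact: (dd (o 0%N isT) (o 1%N isT)).
  - exact: (dd (o 0%N isT) (o 2%N isT)).
  - by rewrite (dd (o 0%N isT) (o 3%N isT)) scaleN1r.
  - by rewrite (dd (o 1%N isT) (o 2%N isT)) scaleN1r.
  - by rewrite (dd (o 1%N isT) (o 3%N isT)) opprK.
  - by rewrite (dd (o 2%N isT) (o 3%N isT)) opprK.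
  - exact: (sq (o 0%N isT)).
  - exact: (sq (o 3%N isT)).
(* Forward, a valid relation is a combination of derived rules, hence of listed ones. Backward, a
   combination of listed rules is one of derived rules, on which [eval_dd] vanishes. *)
move=> no_other C; split=> [/no_other|].
  exact/subvP/derived_sub_listed.
move/(subvP (listed_sub_derived q two0)); apply: linear_span_eq0.
by move=> _ /allpairsP[[i j] [_ _ ->]]; apply: derived0.
Qed.
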